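(* For every integer $n\ge 1$, $$f(n)\ \ge\ H_n:=\sum_{j=0}^{n-1}\binom{j}{\lfloor j/2\rfloor}.$$ Moreover, with $K_n:=\binom{n}{\lfloor n/2\rfloor}$, one has $H_n>K_n$ for every $n\ge 3$, and, as $n\to\infty$, $$\frac{H_n}{K_n}=\begin{cases}1+\dfrac{2}{3n}+O(n^{-2}), & n\text{ even},\\[6pt] 1+\dfrac{4}{3n}+O(n^{-2}), & n\text{ odd}.\end{cases}$$ Consequently, as $n\to\infty$, $f(n)\ge K_n\left(1+\frac{2}{3n}+O(n^{-2})\right)$ for $n$ even, and $f(n)\ge K_n\left(1+\frac{4}{3n}+O(n^{-2})\right)$ for $n$ odd.
   Context: For a finite set $A=\{a_1<\cdots<a_n\}$ of positive integers, $A$ has pairwise distinct subset sums if the $2^n$ numbers $w(S)=\sum_{i\in S}a_i$, $S\subseteq\{1,\dots,n\}$ (with $w(\emptyset)=0$), are pairwise distinct. Define $f(n)$ as the minimum of the largest element $a_n$ over all $n$-element sets $A$ of positive integers having pairwise distinct subset sums. An inequality $f(n)\ge K_n(1+c/n+O(n^{-2}))$ means that $f(n)\ge K_n(1+c/n+\varepsilon_n)$ for some sequence $\varepsilon_n$ with $\varepsilon_n=O(n^{-2})$. *)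

(* Defs.v *)
From mathcomp Require Export all_boot all_order all_algebra.
From mathcomp Require Export boolp classical_sets functions reals topology normedtype.
From mathcomp Require Export sequences landau.
Export Order.TTheory GRing.Theory Num.Theory.
Export numFieldNormedType.Exports.

Set Implicit Arguments.
Unset Strict Implicit.
Unset Printing Implicit Defensive.

(** An [n]-element set [a_1 < ... < a_n] of positive integers is encoded by the
    strictly increasing tuple of its elements; indices run over ['I_n]. *)

Definition subset_sum n (a : n.-tuple nat) (S : {set 'I_n}) : nat :=
  (\sum_(i in S) tnth a i)%N.

Definition distinct_subset_sums n (a : n.-tuple nat) : Prop :=
  injective (subset_sum a).

Definition pos_set n (a : n.-tuple nat) : Prop :=
  sorted ltn a /\ (forall i, 0 < tnth a i)%N.

(** The tuple is increasing, so its last entry is the largest element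
    (by convention it is [0] for the empty tuple). *)
Definition largest n (a : n.-tuple nat) : nat := last 0%N a.

Definition attained (n m : nat) : Prop :=
  exists a : n.-tuple nat,
    [/\ pos_set a, distinct_subset_sums a & largest a = m].

Lemma binary_inj n (b c : nat -> bool) :
  (\sum_(i < n) b i * 2 ^ i = \sum_(i < n) c i * 2 ^ i)%N ->
  forall i, (i < n)%N -> b i = c i.
Proof.
elim: n b c => [//|n IHn] b c; rewrite !big_ord_recl !expn0 !muln1 => E.
have shift (d : nat -> bool) :
    (\sum_(i < n) d (bump 0 i) * 2 ^ bump 0 i =
     (\sum_(i < n) d i.+1 * 2 ^ i).*2)%N.
  rewrite -muln2 big_distrl; apply: eq_bigr => i _.
  by rewrite /bump add1n expnSr mulnA.
move: E; rewrite /= !shift => E.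
have E0 : b 0%N = c 0%N by have := congr1 odd E; rewrite !oddD !odd_double !addbF !oddb.
move: E; rewrite E0 => /addnI/double_inj E.
by case=> [//|i]; rewrite ltnS => /(IHn (b \o S) (c \o S) E).
Qed.

Lemma attained_ex n : exists m, `[< attained n m >].
Proof.
pose a := [tuple (2 ^ i)%N | i < n].
exists (largest a); apply/asboolP; exists a; split=> //.
  split; last by move=> i; rewrite tnth_mktuple expn_gt0.
  have -> : val a = [seq (2 ^ i)%N | i <- iota 0 n].
    by rewrite /= -val_enum_ord -map_comp.
  rewrite (homo_sorted (e := ltn)) ?iota_ltn_sorted // => i j ij.
  by rewrite /= ltn_exp2l.
have sumE (S : {set 'I_n}) :
    subset_sum a S = (\sum_(i < n) [exists j in S, val j == i] * 2 ^ i)%N.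
  rewrite /subset_sum big_mkcond; apply: eq_bigr => i _.
  rewrite tnth_mktuple.
  have -> : [exists j in S, val j == i] = (i \in S).
    apply/existsP/idP => [[j /andP[jS /eqP/val_inj <-]]//|iS].
    by exists i; rewrite iS /=.
  by case: (i \in S); rewrite ?mul1n ?mul0n.
move=> S T; rewrite !sumE.
move=> /(@binary_inj n (fun k => [exists j in S, val j == k])
                       (fun k => [exists j in T, val j == k])) E.
apply/setP => i; have {E} := E i (ltn_ord i).
have inE (U : {set 'I_n}) : [exists j in U, val j == i] = (i \in U).
  apply/existsP/idP => [[j /andP[jU /eqP/val_inj <-]]//|iU].
  by exists i; rewrite iU /=.
by rewrite !inE.
Qed.

Definition f (n : nat) : nat := ex_minn (attained_ex n).

Lemma f_attained n : attained n (f n).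
Proof. by rewrite /f; case: ex_minnP => m /asboolP. Qed.

Lemma f_min n m : attained n m -> (f n <= m)%N.
Proof. by rewrite /f; case: ex_minnP => k _ kmin /asboolP/kmin. Qed.

Definition H (n : nat) : nat := (\sum_(0 <= j < n) 'C(j, j./2))%N.

Definition K (n : nat) : nat := 'C(n, n./2).

(** [n --> oo] along the even, resp. odd, integers. *)
Definition even_oo : set_system nat :=
  within [set n : nat | ~~ odd n]%classic \oo%classic.
Definition odd_oo : set_system nat :=
  within [set n : nat | odd n]%classic \oo%classic.

Canonical even_oo_filter_on :=
  FilterType even_oo (within_filter _ (@filter_class _ \oo%classic)).
Canonical odd_oo_filter_on :=
  FilterType odd_oo (within_filter _ (@filter_class _ \oo%classic)).

(* Main.v *)
(** Let N_k(t) be the number of subset sums of a_1 < ... < a_k that are at most t,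
    so that N_k(t) = N_(k-1)(t) + N_(k-1)(t - a_k). As the sums are distinct
    integers, N_n(t + a_n) - N_n(t) <= a_n, and it suffices to find t where this
    difference is at least H_n. Integers P(k, r) such that N_k(t) >= P(k, r)
    implies N_k(t + b) >= P(k, r + 1) for every b >= a_k are obtained by induction
    on k provided that P(k, r) is P(k-1, r) + P(k-1, r-1), or one less than that,
    the latter for small r only. Subtracting 1 at row i for r <= rho_i
    contributes binom(n - i, r - rho_i) to P(n, r + 1) - P(n, r), and at
    r = floor(n/2) the choice rho_i = r - floor((n - i)/2) makes these
    contributions add up to H_n; any t with N_n(t) = P(n, r) then works.

    The asymptotics follow from H_(n+1) = H_n + K_n, K_(2m+2) = 2 K_(2m+1) and
    (m + 1) K_(2m+1) = (2m + 1) K_(2m): they make H_(2m)/K_(2m) the orbit of an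
    affine recursion whose contraction factor tends to 1/4. *)
Require Import Defs.
From mathcomp Require Import zify ring lra.

(** * Subset sums of a list, with multiplicity, and their counting function *)

Fixpoint sums (s : seq nat) : seq nat :=
  if s is x :: s' then sums s' ++ map (addn x) (sums s') else [:: 0%N].

Definition cnt (s : seq nat) (t : nat) : nat := count (leq^~ t) (sums s).

Lemma cnt_cons x s t :
  cnt (x :: s) t = (cnt s t + (if x <= t then cnt s (t - x) else 0))%N.
Proof.
rewrite /cnt /= count_cat count_map; congr (_ + _)%N.
case: leqP => xt; last first.
  apply/eqP; rewrite -leqn0 leqNgt -has_count -all_predC.
  by apply/allP => y _ /=; lia.
by apply: eq_count => y /=; lia.
Qed.

Lemma leq_cnt s t u : (t <= u)%N -> (cnt s t <= cnt s u)%N.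
Proof. by move=> tu; apply: sub_count => y /= /leq_trans; apply. Qed.

Lemma cnt_sumn s : cnt s (sumn s) = (2 ^ size s)%N.
Proof.
have le_sums v : v \in sums s -> (v <= sumn s)%N.
  elim: s v => [|x s IHs] v /=; first by rewrite inE => /eqP ->.
  rewrite mem_cat => /orP[/IHs|/mapP[y /IHs ys ->]]; last by rewrite leq_add2l.
  by move/leq_trans; apply; rewrite leq_addl.
have /eqP -> : cnt s (sumn s) == size (sums s) by rewrite -all_count; apply/allP.
elim: s {le_sums} => //= x s IHs; rewrite size_cat size_map IHs expnS; lia.
Qed.

Lemma cnt0 s : all (ltn 0) s -> cnt s 0 = 1%N.
Proof. by elim: s => //= -[|x] s IHs //= s0; rewrite cnt_cons IHs. Qed.

(** Each of the [d] integers in [(t, t + d]] is hit by at most one subset sum. *)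
Lemma cnt_step s t d : uniq (sums s) -> (cnt s (t + d) <= cnt s t + d)%N.
Proof.
move=> us; elim: d => [|d IHd]; first by rewrite !addn0.
rewrite !addnS; apply: (@leq_trans (cnt s (t + d) + count_mem (t + d).+1 (sums s))).
  rewrite /cnt -count_predUI -[leqLHS]addn0 leq_add //.
  by apply: sub_count => y /=; lia.
by rewrite count_uniq_mem //; case: (_ \in _); lia.
Qed.

(** Discrete intermediate values: the count starts at 1, the empty sum, ends at [2 ^ size s], and
    grows by at most 1 per step. *)
Lemma cnt_ivt s m : all (ltn 0) s -> uniq (sums s) ->
  (0 < m <= 2 ^ size s)%N -> exists t, cnt s t = m.
Proof.
move=> s0 us /andP[m0 m2].
have ex : exists t, (m <= cnt s t)%N by exists (sumn s); rewrite cnt_sumn.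
case: (ex_minnP ex) => -[|t] mt tmin.
  by exists 0%N; move: mt; rewrite cnt0 //; lia.
exists t.+1; have := @cnt_step s t 1 us; rewrite addn1.
by case: (leqP m (cnt s t)) => [/tmin|]; rewrite ?ltnn //; lia.
Qed.

Lemma mem_sums s v :
  v \in sums s -> exists2 m : bitseq, size m = size s & v = sumn (mask m s).
Proof.
elim: s v => [|x s IHs] v /=; first by rewrite inE => /eqP ->; exists [::].
rewrite mem_cat => /orP[/IHs[m ms ->]|/mapP[_ /IHs[m ms ->] ->]].
  by exists (false :: m); rewrite //= ms.
by exists (true :: m); rewrite //= ms.
Qed.

Lemma uniq_sums s :
  {in [pred m : bitseq | size m == size s] &, injective (fun m => sumn (mask m s))} ->
  uniq (sums s).
Proof.
elim: s => //= x s IHs inj.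
have inj1 (m1 m2 : bitseq) : size m1 = size s -> size m2 = size s ->
    sumn (mask m1 s) = sumn (mask m2 s) -> m1 = m2.
  move=> s1 s2 E.
  suff [] : true :: m1 = true :: m2 by [].
  by apply: inj; rewrite ?inE /= ?s1 ?s2 ?E.
have us : uniq (sums s).
  by apply: IHs => m1 m2; rewrite !inE => /eqP s1 /eqP s2; apply: inj1.
rewrite cat_uniq us map_inj_uniq ?us ?andbT /=; last exact: addnI.
apply/hasPn => _ /mapP[_ /mem_sums[m1 s1 ->] ->].
apply/negP => /mem_sums[m2 s2 E].
suff : true :: m1 = false :: m2 by [].
by apply: inj; rewrite ?inE /= ?s1 ?s2.
Qed.

Lemma sumn_mask (m : bitseq) (s : seq nat) : size m = size s ->
  sumn (mask m s) = (\sum_(i < size s | nth false m i) nth 0 s i)%N.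
Proof.
rewrite big_mkcond; elim: s m => [|x s IHs] [|b m] //=; first by rewrite big_ord0.
by case=> /IHs E; rewrite big_ord_recl /= -E; case: b.
Qed.

(** The reversal puts the largest element at the head, where [cnt_cons] peels it off first. *)
Lemma uniq_sums_tuple n (a : n.-tuple nat) :
  distinct_subset_sums a -> uniq (sums (rev a)).
Proof.
move=> inj; apply: uniq_sums => m1 m2; rewrite !inE !size_rev => /eqP s1 /eqP s2.
have revE (m : bitseq) : size m = size a ->
    sumn (mask m (rev a)) = subset_sum a [set i : 'I_n | nth false (rev m) i].
  move=> sm; rewrite -sumn_rev rev_mask ?size_rev // revK sumn_mask ?size_rev //.
  rewrite /subset_sum size_tuple; apply: eq_big => [i|i _]; first by rewrite inE.
  by rewrite (tnth_nth 0%N).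
rewrite !revE // => /inj/setP E; apply: (can_inj revK).
apply: (@eq_from_nth _ false); rewrite !size_rev ?s1 ?s2 // => i.
by rewrite size_tuple => lt_in; have := E (Ordinal lt_in); rewrite !inE.
Qed.

(** * Levels that the counting function climbs *)

(** [level rho k r] is the P(k, r) of the header; truncation makes [r.-1 = 0] at
    [r = 0], so that [level rho k 0 = 1]. *)
Fixpoint level (rho : nat -> nat) (k r : nat) : nat :=
  if k is k'.+1 then (level rho k' r + level rho k' r.-1 - (r <= rho k))%N else 1%N.

Lemma level_gt0 rho k r : (0 < level rho k r)%N.
Proof. by elim: k r => //= k IHk r; have := IHk r; have := IHk r.-1; lia. Qed.

Lemma level_le rho k r : (level rho k r <= 2 ^ k)%N.
Proof.
by elim: k r => //= k IHk r; have := IHk r; have := IHk r.-1; rewrite expnS; lia.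
Qed.

(** Pascal's rule on each earlier row; row [k.+1] itself adds 1 exactly when [rho k.+1 = r]. Levels
    are positive, so the subtraction in [level] never truncates. *)
Lemma level_S rho k r :
  level rho k r.+1 =
  (level rho k r + \sum_(i < k) (rho i.+1 <= r) * 'C(k - i.+1, r - rho i.+1))%N.
Proof.
elim: k r => [|k IHk] r; first by rewrite big_ord0.
have pascal (i : 'I_k) : ((rho i.+1 <= r) * 'C(k.+1 - i.+1, r - rho i.+1) =
    (rho i.+1 <= r) * 'C(k - i.+1, r - rho i.+1) +
    (rho i.+1 < r) * 'C(k - i.+1, r.-1 - rho i.+1))%N.
  rewrite subSn //; case: (ltngtP (rho i.+1) r) => [rr||->].
  - by rewrite (_ : r - _ = (r.-1 - rho i.+1).+1)%N ?binS; lia.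
  - by rewrite !mul0n.
  - by rewrite subnn !bin0.
rewrite big_ord_recr /= (eq_bigr _ (fun i _ => pascal i)) big_split /=.
rewrite subnn bin0n IHk {pascal}.
have := level_gt0 rho k r; have := level_gt0 rho k r.-1.
case: r => [|r] /=.
  by rewrite [X in (_ + (_ + X + _))%N]big1 => [|i _]; [lia | rewrite mul0n].
by rewrite (IHk r); set S := (\sum_(i < k) _)%N; set S' := (\sum_(i < k) _)%N; lia.
Qed.

(** With this [rho] each term of [level_S] at [r = n./2] is a central binomial
    coefficient. *)
Lemma level_peak n : let rho i := (n./2 - (n - i)./2)%N in
  level rho n n./2.+1 = (level rho n n./2 + H n)%N.
Proof.
move=> rho; rewrite level_S; congr addn.
rewrite /H big_rev_mkord subn0; apply: eq_bigr => i _ /=.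
have := ltn_ord i.
have -> : (rho i.+1 <= n./2)%N by rewrite /rho leq_subr.
by rewrite mul1n /rho subKn // half_leq // leq_subr.
Qed.

(** If [cnt s t] were smaller than [level rho (size s) r], thus by at least 1, then
    [cnt s (t - x)] would be at least [level rho (size s) r.-1] in spite of the 1
    subtracted in [level], and the induction hypothesis with shift [x] would
    contradict the smallness of [cnt s t]. *)
Lemma cnt_shift rho b s r t : path geq b s ->
  (level rho (size s) r <= cnt s t)%N -> (level rho (size s) r.+1 <= cnt s (t + b))%N.
Proof.
elim: s b r t => [//|x s IHs] b r t /= /andP[xb xs] Pt.
have {}xb : (x <= b)%N := xb.
have step : (level rho (size s) r <= cnt s t)%N.
  rewrite leqNgt; apply/negP => Plt; move: Pt; rewrite cnt_cons.
  case: (leqP x t) => [xt|_]; last by have := level_gt0 rho (size s) r.-1; lia.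
  move=> Pt; have {Pt} : (level rho (size s) r.-1 <= cnt s (t - x))%N by lia.
  case: r Plt => [|r] Plt /=.
    by have := @leq_cnt s _ _ (leq_subr x t); lia.
  by move/(IHs x _ _ xs); rewrite subnK //; lia.
have bs : path geq b s.
  by case: s xs {IHs Pt step} => //= y s /andP[yx ->]; rewrite andbT (leq_trans yx xb).
have := IHs b r t bs step; rewrite cnt_cons ifT; last by lia.
have := @leq_cnt s t (t + b - x) ltac:(lia).
by lia.
Qed.

(** * The bound [H n <= f n] *)

Lemma H_le_largest n (a : n.-tuple nat) :
  pos_set a -> distinct_subset_sums a -> (H n <= largest a)%N.
Proof.
move=> [sa a0] /uniq_sums_tuple us.
pose rho i := (n./2 - (n - i)./2)%N.
have sz : size (rev a) = n by rewrite size_rev size_tuple.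
have pos : all (ltn 0) (rev a).
  by rewrite all_rev; apply/allP => x /tnthP[i ->]; apply: a0.
have [t tE] : exists t, cnt (rev a) t = level rho n n./2.
  by apply: cnt_ivt; rewrite // sz level_gt0 level_le.
(* The head of [rev a] is the largest element itself, so the shift in [cnt_shift] can be exactly
   that element. *)
have pa : path geq (largest a) (rev a).
  have : sorted geq (rev a).
    by rewrite rev_sorted; apply: sub_sorted sa => x y /ltnW.
  rewrite /largest; case/lastP: (val a) => // s x.
  by rewrite last_rcons rev_rcons /= leqnn.
have := @cnt_shift rho _ _ n./2 t pa; rewrite sz tE => /(_ (leqnn _)).
rewrite level_peak => /leq_trans/(_ (@cnt_step _ t (largest a) us)).
by rewrite tE leq_add2l.
Qed.

Lemma H_le_f n : (H n <= f n)%N.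
Proof. by have [a [pa da <-]] := f_attained n; apply: H_le_largest. Qed.

(** * Central binomial recursions and [K n < H n] *)

Lemma K_doubleS m : K m.+1.*2 = (2 * K m.*2.+1)%N.
Proof.
have sym : 'C(m.*2.+1, m.+1) = 'C(m.*2.+1, m).
  by rewrite -[RHS]bin_sub ?subSn -addnn ?addnK ?leqW ?leq_addr.
by rewrite /K doubleS /= half_double binS uphalf_double sym mul2n addnn.
Qed.

Lemma K_double m : (m.+1 * K m.*2.+1 = m.*2.+1 * K m.*2)%N.
Proof.
rewrite /K /= uphalf_double doubleK; have := mul_bin_down m.*2.+1 m.
by rewrite (_ : m.*2.+1 - m = m.+1)%N //; lia.
Qed.

Lemma HS n : H n.+1 = (H n + K n)%N.
Proof. by rewrite /H big_nat_recr. Qed.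

Lemma K_gt0 n : (0 < K n)%N.
Proof. by rewrite bin_gt0; lia. Qed.

Lemma K_le n : (K n.+1 <= 2 * K n)%N.
Proof.
have [m [->|->]] : exists m, n = m.*2 \/ n = m.*2.+1 by exists n./2; lia.
  by rewrite -(leq_pmul2l (ltn0Sn m)) K_double mulnCA mulnA leq_mul2r; lia.
by rewrite -doubleS K_doubleS.
Qed.

(** Base [4 > 3]; then [H n + K n > 2 * K n >= K n.+1]. *)
Lemma K_lt_H n : (3 <= n)%N -> (K n < H n)%N.
Proof.
elim: n => // n IHn; rewrite leq_eqVlt => /predU1P[[<-]|/IHn KH].
  by rewrite /H /K !big_nat_recr // big_geq.
by rewrite HS; have := K_le n; lia.
Qed.

(** * Asymptotics of [H n / K n] *)

Local Open Scope ring_scope.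

Definition ratio (R : realType) (n : nat) : R :=
  (H n)%:R / (K n)%:R.

Lemma ratio_double (R : realType) (m : nat) :
  ratio R m.*2.+1 = (ratio R m.*2 + 1) * (m.+1%:R / m.*2.+1%:R).
Proof.
have k0 n : (K n)%:R != 0 :> R by rewrite pnatr_eq0 -lt0n K_gt0.
have kE : m.+1%:R * (K m.*2.+1)%:R = m.*2.+1%:R * (K m.*2)%:R :> R.
  by rewrite -!natrM K_double.
have m0 : m.*2.+1%:R != 0 :> R by rewrite pnatr_eq0.
have m1 : m.+1%:R != 0 :> R by rewrite pnatr_eq0.
rewrite /ratio HS natrD.
have -> : (K m.*2.+1)%:R = m.*2.+1%:R * (K m.*2)%:R / m.+1%:R :> R.
  by rewrite -kE mulrC mulKf.
move: (k0 m.*2) m0 m1; move: (K m.*2)%:R (m.*2.+1)%:R (m.+1)%:R => k a b k1 a0 b0.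
by field; rewrite k1 a0 b0.
Qed.

Lemma ratio_doubleS (R : realType) (m : nat) :
  ratio R m.+1.*2 = (ratio R m.*2.+1 + 1) / 2.
Proof.
have k0 n : (K n)%:R != 0 :> R by rewrite pnatr_eq0 -lt0n K_gt0.
rewrite /ratio K_doubleS doubleS HS natrD natrM.
by field; rewrite k0.
Qed.

(** The recursion from [m] to [m + 1] is increasing in the ratio, so both bounds propagate once
    rational functions of [m] are checked to be nonnegative. The start is [m = 2], where the lower
    bound is the equality [7/6]; at [m = 1] the ratio is 1 and the lower bound fails. *)
Lemma ratio_even_bounds (R : realType) (m : nat) : (2 <= m)%N ->
  1 + (3 * m%:R)^-1 <= ratio R m.*2 <= 1 + (3 * m%:R)^-1 + 2 * m%:R ^- 2.
Proof.
elim: m => // m IHm; rewrite leq_eqVlt => /predU1P[[<-]|m2].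
  have H4 : H 2.*2 = 7%N by rewrite /H !big_nat_recr // big_geq.
  by rewrite /ratio H4 (_ : K 2.*2 = 6%N) //; lra.
have /andP[lo up] := IHm m2.
rewrite ratio_doubleS ratio_double.
have mE : m.*2.+1%:R = 2 * m%:R + 1 :> R by rewrite -natr1 -mul2n natrM.
rewrite mE -[m.+1%:R]natr1; set x : R := m%:R in lo up *.
have x2 : 2 <= x by rewrite ler_nat.
have c0 : 0 <= (x + 1) / (2 * x + 1) by rewrite divr_ge0; lra.
have x0 : x != 0 by rewrite gt_eqF; lra.
have x1 : x + 1 != 0 by rewrite gt_eqF; lra.
have x21 : 2 * x + 1 != 0 by rewrite gt_eqF; lra.
have lo' := ler_wpM2r c0 (lerD lo (lexx 1)).
have up' := ler_wpM2r c0 (lerD up (lexx 1)).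
set y := (ratio R _ + 1) * _ in lo' up' *.
apply/andP; split.
  apply: (@le_trans _ _ (((1 + (3 * x)^-1 + 1) * ((x + 1) / (2 * x + 1)) + 1) / 2));
    last by rewrite ler_pM2r ?invr_gt0 // lerD2r.
  rewrite -subr_ge0.
  have -> : ((1 + (3 * x)^-1 + 1) * ((x + 1) / (2 * x + 1)) + 1) / 2 -
      (1 + (3 * (x + 1))^-1)
     = (3 * x + 1) / (6 * x * (2 * x + 1) * (x + 1)).
    by field; rewrite x0 x1 x21.
  by rewrite divr_ge0 ?mulr_ge0; lra.
apply: (@le_trans _ _ (((1 + (3 * x)^-1 + 2 * x ^- 2 + 1) *
    ((x + 1) / (2 * x + 1)) + 1) / 2)); first by rewrite ler_pM2r ?invr_gt0 // lerD2r.
rewrite -subr_ge0.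
have -> : 1 + (3 * (x + 1))^-1 + 2 * (x + 1) ^- 2 -
   ((1 + (3 * x)^-1 + 2 * x ^- 2 + 1) * ((x + 1) / (2 * x + 1)) + 1) / 2
     = (15 * x ^+ 3 - 10 * x ^+ 2 - 19 * x - 6) / (6 * x ^+ 2 * (2 * x + 1) * (x + 1) ^+ 2).
  by field; rewrite x0 x1 x21.
rewrite divr_ge0 //; first by nra.
by rewrite !mulr_ge0 ?exprn_ge0; lra.
Qed.

Lemma ratio_even_error (R : realType) (n : nat) : (4 <= n)%N -> ~~ odd n ->
  `|ratio R n - (1 + 2 / (3 * n%:R))| <= 8 * n%:R ^- 2.
Proof.
move=> n4 ne; have [m m2 ->] : exists2 m, (2 <= m)%N & n = m.*2 by exists n./2; lia.
have /andP[lo up] := @ratio_even_bounds R m m2.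
have -> : m.*2%:R = 2 * m%:R :> R by rewrite -mul2n natrM.
have m0 : m%:R != 0 :> R by rewrite pnatr_eq0; lia.
have -> : 2 / (3 * (2 * m%:R)) = (3 * m%:R)^-1 :> R by field.
have -> : 8 * (2 * m%:R) ^- 2 = 2 * m%:R ^- 2 :> R by field.
by rewrite ger0_norm; lra.
Qed.

Lemma ratio_odd_error (R : realType) (n : nat) : (5 <= n)%N -> odd n ->
  `|ratio R n - (1 + 4 / (3 * n%:R))| <= 20 * n%:R ^- 2.
Proof.
move=> n4 no; have [m m2 ->] : exists2 m, (2 <= m)%N & n = m.*2.+1 by exists n./2; lia.
have /andP[lo up] := @ratio_even_bounds R m m2.
have {m2 n4 no n} x2 : 2 <= m%:R :> R by rewrite ler_nat.
rewrite ratio_double.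
have -> : m.*2.+1%:R = 2 * m%:R + 1 :> R by rewrite -natr1 -mul2n natrM.
rewrite -[m.+1%:R]natr1; set x : R := m%:R in lo up x2 *.
have c0 : 0 <= (x + 1) / (2 * x + 1) by rewrite divr_ge0; lra.
have x0 : x != 0 by rewrite gt_eqF; lra.
have x21 : 2 * x + 1 != 0 by rewrite gt_eqF; lra.
have lo' := ler_wpM2r c0 (lerD lo (lexx 1)).
have up' := ler_wpM2r c0 (lerD up (lexx 1)).
set y := (ratio R _ + 1) * _ in lo' up' *.
(* The lower bound already exceeds the main term, so the error is nonnegative and only its upper
   bound remains. *)
have loE : (1 + (3 * x)^-1 + 1) * ((x + 1) / (2 * x + 1)) - (1 + 4 / (3 * (2 * x + 1)))
   = (3 * x * (2 * x + 1))^-1 by field; rewrite x0 x21.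
have lo0 : 0 <= (3 * x * (2 * x + 1))^-1 by rewrite invr_ge0 mulr_ge0; lra.
rewrite ger0_norm; last by rewrite (le_trans lo0) // -loE lerD2r.
apply: (@le_trans _ _ ((1 + (3 * x)^-1 + 2 * x ^- 2 + 1) * ((x + 1) / (2 * x + 1)) -
    (1 + 4 / (3 * (2 * x + 1))))); first by rewrite lerD2r.
rewrite -subr_ge0.
have -> : 20 * (2 * x + 1) ^- 2 -
    ((1 + (3 * x)^-1 + 2 * x ^- 2 + 1) * ((x + 1) / (2 * x + 1)) -
     (1 + 4 / (3 * (2 * x + 1))))
  = (60 * x ^+ 2 - x * (2 * x + 1) - 6 * (x + 1) * (2 * x + 1)) /
    (3 * x ^+ 2 * (2 * x + 1) ^+ 2).
  by field; rewrite x0 x21.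
rewrite divr_ge0 //; first by nra.
by rewrite !mulr_ge0 ?exprn_ge0; lra.
Qed.

Lemma bigO_within (R : realType) (D : set nat) (F : filter_on nat) (g : nat -> R)
    (c : R) :
  (forall n, (5 <= n)%N -> D n -> `|g n| <= c * n%:R ^- 2) ->
  F = within D \oo%classic :> set_system nat ->
  g =O_F (fun n : nat => n%:R ^- 2 : R).
Proof.
move=> gc FE; apply/eqOP; near=> k; rewrite FE near_withinE.
near=> n => Dn; apply: le_trans (gc n _ Dn) _; first by near: n; exists 5%N.
have -> : `|n%:R ^- 2| = n%:R ^- 2 :> R by rewrite ger0_norm // invr_ge0 exprn_ge0.
rewrite ler_wpM2r ?invr_ge0 ?exprn_ge0 //.
near: k; apply: nbhs_pinfty_ge; exact: num_real.
Unshelve. all: by end_near.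
Qed.

Theorem theorem1p1 (R : realType) :
  (forall n : nat, (1 <= n)%N -> (H n <= f n)%N)
  /\ (forall n : nat, (3 <= n)%N -> (K n < H n)%N)
  /\ ((fun n : nat => (H n)%:R / (K n)%:R : R) =
        (fun n : nat => 1 + 2 / (3 * n%:R) : R)
        +O_even_oo (fun n : nat => n%:R ^- 2 : R))
  /\ ((fun n : nat => (H n)%:R / (K n)%:R : R) =
        (fun n : nat => 1 + 4 / (3 * n%:R) : R)
        +O_odd_oo (fun n : nat => n%:R ^- 2 : R))
  /\ (exists eps : nat -> R,
        eps =O_even_oo (fun n : nat => n%:R ^- 2 : R) /\
        forall n : nat, (1 <= n)%N -> ~~ odd n ->
          (K n)%:R * (1 + 2 / (3 * n%:R) + eps n) <= (f n)%:R)
  /\ (exists eps : nat -> R,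
        eps =O_odd_oo (fun n : nat => n%:R ^- 2 : R) /\
        forall n : nat, (1 <= n)%N -> odd n ->
          (K n)%:R * (1 + 4 / (3 * n%:R) + eps n) <= (f n)%:R).
Proof.
(* With [eps n] the exact error of the ratio, the left side is [H n]. *)
have ratio_le_f n e : (K n)%:R * (1 + e + (ratio R n - (1 + e))) <= (f n)%:R.
  rewrite addrC subrK /ratio mulrC divfK ?pnatr_eq0 -?lt0n ?K_gt0 //.
  by rewrite ler_nat H_le_f.
have even_error : (fun n => ratio R n - (1 + 2 / (3 * n%:R)))
    =O_even_oo (fun n : nat => n%:R ^- 2 : R).
  by apply: (@bigO_within _ _ _ _ 8) => // n /ltnW; apply: ratio_even_error.
have odd_error : (fun n => ratio R n - (1 + 4 / (3 * n%:R)))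
    =O_odd_oo (fun n : nat => n%:R ^- 2 : R).
  by apply: (@bigO_within _ _ _ _ 20) => // n; apply: ratio_odd_error.
split; first by move=> n _; apply: H_le_f.
split; first exact: K_lt_H.
split; first by apply/eqaddOP; move/eqOP: even_error.
split; first by apply/eqaddOP; move/eqOP: odd_error.
split.
  by exists (fun n => ratio R n - (1 + 2 / (3 * n%:R))); split=> // n _ _.
by exists (fun n => ratio R n - (1 + 4 / (3 * n%:R))); split=> // n _ _.
Qed.
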